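(* Let $\Gamma$ be a finite group and let $A\subseteq\Gamma$. Define $\mathcal{C}_A:\Gamma\times\Gamma\to\mathbb{R}$ by $$\mathcal{C}_A(x,y):=\frac{|xA\cap Ay|}{|\Gamma|}.$$ Then for every finite directed graph $F$, $$t(F,\mathcal{C}_A)\;\geq\;\left(\frac{|A|}{|\Gamma|}\right)^{2e(F)}.$$ Equivalently, for every finite directed graph $F$, $$t(F,\mathcal{C}_A)\;\geq\; t(\overrightarrow{K_2},\mathcal{C}_A)^{e(F)}.$$
   Context: Here $xA=\{xa:a\in A\}$ and $Ay=\{ay:a\in A\}$. For a finite set $S$, $\mathbb{E}_{s\in S}$ denotes the uniform average $\frac{1}{|S|}\sum_{s\in S}$. For a finite directed graph $F$ with vertex set $V(F)$ and directed edge set $E(F)$, write $e(F)=|E(F)|$, and for $e\in E(F)$ write $e^-$ for the tail and $e^+$ for the head of $e$ (so $e$ is directed from $e^-$ to $e^+$). For a kernel $W:\Gamma\times\Gamma\to\mathbb{R}$ on a finite group $\Gamma$ (equipped with the uniform probability measure), the directed homomorphism density is $$t(F,W):=\mathbb{E}_{x:V(F)\to\Gamma}\ \prod_{e\in E(F)}W(x_{e^-},x_{e^+}),$$ the average being over all maps $x:V(F)\to\Gamma$. $\overrightarrow{K_2}$ is the directed graph on two vertices consisting of one directed edge, so $t(\overrightarrow{K_2},W)=\mathbb{E}_{x,y\in\Gamma}W(x,y)$. Empty products and zeroth powers equal $1$. *)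

(* Defs.v *)
From mathcomp Require Import all_boot all_order all_algebra all_fingroup.
From mathcomp Require Import reals.

Set Implicit Arguments.
Unset Strict Implicit.
Unset Printing Implicit Defensive.

Import Order.TTheory GRing.Theory Num.Theory.
Local Open Scope ring_scope.

(* Loops, antiparallel edges and parallel edges are all allowed; digraphs whose
   edges are ordered pairs are the case where (tail, head) is injective. *)
Record digraph := Digraph {
  vertex : finType;
  edge : finType;
  tail : edge -> vertex;
  head : edge -> vertex
}.

Definition num_edges (F : digraph) : nat := #|edge F|.

Definition dirK2 : digraph :=
  @Digraph 'I_2 unit (fun=> ord0) (fun=> ord_max).

Definition avg (R : realType) (S : finType) (f : S -> R) : R :=
  (\sum_(s : S) f s) / #|S|%:R.

Definition hom_density (R : realType) (T : finType) (F : digraph)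
    (W : T -> T -> R) : R :=
  avg (fun x : {ffun vertex F -> T} =>
         \prod_(e : edge F) W (x (tail e)) (x (head e))).

Definition coset_kernel (R : realType) (gT : finGroupType) (A : {set gT})
    (x y : gT) : R :=
  #|(x *: A)%g :&: (A :* y)%g|%:R / #|gT|%:R.

(* Main.v *)
Require Import Defs.
From mathcomp Require Import all_boot all_order all_algebra all_fingroup.
From mathcomp Require Import reals.

Set Implicit Arguments.
Unset Strict Implicit.
Unset Printing Implicit Defensive.

Import Order.TTheory GRing.Theory Num.Theory.
Local Open Scope ring_scope.

(** Write [f] for the indicator of [A] and [G] for the ambient group.
Substituting [z = b y] in the count of [xA :&: Ay] gives
[C_A(x, y) = E_b f(b) f(x^-1 b y)].  Choosing a variable [a_e] for every edge
and multiplying out,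

  [t(F, C_A) = E_x E_a g(a) g(a . x)],   [g(a) = \prod_e f(a_e)],

where [(a . x)_e = x_(tail e)^-1 a_e x_(head e)] is a right action of the
gauge group [G^V] on [G^E].  For any finite group acting on any finite set,
averaging over the group is the orthogonal projection [P] onto the invariant
functions, so such an average equals [<g, P g> = |P g|^2], which is at least
[(E P g)^2 = (E g)^2] (lemma [avg_correlation_ge]).  Here [g] is a product
over independent coordinates, so [(E g)^2 = (E f)^(2 e(F))].

The second form follows because a single edge attains equality: for fixed [b],
the element [x^-1 b y] is uniformly distributed on [G]. *)

Section Averages.

Variable R : realType.

Lemma eq_avg (S : finType) (f g : S -> R) : f =1 g -> avg f = avg g.
Proof. by move=> fg; congr (_ / _); apply: eq_bigr => s _; apply: fg. Qed.

Lemma avg_const (S : finType) (s0 : S) (c : R) : avg (fun _ : S => c) = c.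
Proof.
rewrite /avg sumr_const -[c *+ _]mulr_natr mulfK // pnatr_eq0 -lt0n.
by apply/card_gt0P; exists s0.
Qed.

Lemma avgD (S : finType) (f g : S -> R) :
  avg (fun s => f s + g s) = avg f + avg g.
Proof. by rewrite /avg big_split mulrDl. Qed.

Lemma avgZ (S : finType) (c : R) (f : S -> R) :
  avg (fun s => c * f s) = c * avg f.
Proof. by rewrite /avg -mulr_sumr mulrA. Qed.

Lemma avg_ge0 (S : finType) (f : S -> R) : (forall s, 0 <= f s) -> 0 <= avg f.
Proof. by move=> f0; rewrite divr_ge0 ?ler0n // sumr_ge0. Qed.

Lemma exchange_avg (S T : finType) (f : S -> T -> R) :
  avg (fun s => avg (f s)) = avg (fun t => avg (f^~ t)).
Proof.
rewrite /avg -!mulr_suml exchange_big /= -!mulrA; congr (_ * _).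
by rewrite mulrC.
Qed.

Lemma avg_reindex (S : finType) (h : S -> S) (f : S -> R) :
  injective h -> avg f = avg (f \o h).
Proof. by move=> injh; rewrite /avg (reindex_inj injh). Qed.

Lemma avg_indicator (T : finType) (A : {set T}) :
  avg (fun t => (t \in A)%:R : R) = #|A|%:R / #|T|%:R.
Proof. by rewrite /avg -natr_sum -big_mkcond /= sum1_card. Qed.

(** The coordinates of a uniformly random function are independent. *)
Lemma avg_prod (I T : finType) (f : I -> T -> R) :
  avg (fun a : {ffun I -> T} => \prod_i f i (a i)) = \prod_i avg (f i).
Proof.
rewrite /avg -bigA_distr_bigA /= big_split /= prodr_const.
by rewrite card_ffun natrX exprVn.
Qed.

Lemma sqr_avg_le (S : finType) (s0 : S) (f : S -> R) :
  avg f ^+ 2 <= avg (fun s => f s ^+ 2).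
Proof.
set m := avg f; rewrite -subr_ge0.
(* The difference is the variance of [f]. *)
suff -> : avg (fun s => f s ^+ 2) - m ^+ 2 = avg (fun s => (f s - m) ^+ 2).
  by apply: avg_ge0 => s; apply: sqr_ge0.
rewrite [RHS](@eq_avg _ _ (fun s => (f s ^+ 2 + (- (m *+ 2)) * f s) + m ^+ 2)).
  rewrite !avgD avgZ avg_const // -/m -addrA mulNr mulrnAl -expr2 mulr2n.
  by rewrite opprD addrNK.
by move=> s; rewrite sqrrB mulNr mulrnAl [m * _]mulrC.
Qed.

(** Averaging [g] over the orbits is a self-adjoint projection [P], so the
left-hand average is [<g, P g> = |P g|^2]; in the proof this is the change of
variables [h -> k h] followed by [a . k -> a].  The bound is then the
inequality between the square of the mean of [P g] and its mean square. *)
Lemma avg_correlation_ge (hT : finGroupType) (T : finType)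
    (to : {action hT &-> T}) (t0 : T) (g : T -> R) :
  avg (fun h => avg (fun a => g a * g (to a h))) >= avg g ^+ 2.
Proof.
have avg_act (f : T -> R) h : avg (fun a => f (to a h)) = avg f.
  by rewrite [RHS](avg_reindex _ (act_inj to h)).
pose Pg a := avg (fun h => g (to a h)).
have -> : avg g = avg Pg.
  rewrite /Pg exchange_avg -[LHS](avg_const (1%g : hT)).
  by apply: eq_avg => h; rewrite avg_act.
apply: (le_trans (sqr_avg_le t0 Pg)); rewrite le_eqVlt; apply/orP; left.
have -> : avg (fun a => Pg a ^+ 2) =
    avg (fun a => avg (fun k => avg (fun h => g (to a k) * g (to (to a k) h)))).
  apply: eq_avg => a; rewrite expr2 -[LHS]avgZ; apply: eq_avg => k.
  rewrite mulrC avgZ; congr (_ * _).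
  rewrite /Pg (avg_reindex _ (mulgI k)).
  by apply: eq_avg => h /=; rewrite actM.
rewrite exchange_avg -[eqbRHS](avg_const (1%g : hT)); apply/eqP.
apply: eq_avg => k; rewrite exchange_avg; apply: eq_avg => h.
exact: (avg_act (fun a => g a * g (to a h))).
Qed.

End Averages.

Section Kernel.

Variables (R : realType) (gT : finGroupType).

(** The correlation kernel of [f]; for the indicator of a set [A] this is the
coset kernel of [A]. *)
Definition corr_kernel (f : gT -> R) (x y : gT) : R :=
  avg (fun b => f b * f (x^-1 * b * y)%g).

Lemma coset_kernelE (A : {set gT}) :
  coset_kernel R A =2 corr_kernel (fun b => (b \in A)%:R).
Proof.
move=> x y; rewrite /coset_kernel -avg_indicator (avg_reindex _ (mulIg y)).
apply: eq_avg => b /=.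
by rewrite inE mem_lcoset mem_rcoset mulgK andbC -mulnb natrM mulgA.
Qed.

Section GaugeAction.

Variable F : digraph.

(** A vertex labelling [x] acts on edge labellings by changing the frame at
both ends of each edge.  The type of [x] is spelled as a dependent product
because that is the form which carries the finite group structure. *)
Definition gauge (a : {ffun edge F -> gT})
    (x : {dffun forall _ : vertex F, gT}) : {ffun edge F -> gT} :=
  [ffun e => ((x (tail e))^-1 * a e * x (Defs.head e))%g].

Lemma gauge1 : gauge^~ 1%g =1 id.
Proof. by move=> a; apply/ffunP=> e; rewrite !ffunE invg1 mul1g mulg1. Qed.

Lemma gaugeM a x y : gauge a (x * y)%g = gauge (gauge a x) y.
Proof. by apply/ffunP=> e; rewrite !ffunE invMg !mulgA. Qed.

Definition gauge_action := TotalAction gauge1 gaugeM.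

End GaugeAction.

(** Multiplying out the edge factors turns the density into the correlation of
the product function [g] with its translates under the gauge action. *)
Lemma hom_density_corr_ge (f : gT -> R) (F : digraph) :
  hom_density F (corr_kernel f) >= avg f ^+ (2 * num_edges F).
Proof.
pose g (a : {ffun edge F -> gT}) := \prod_e f (a e).
have <- : avg g ^+ 2 = avg f ^+ (2 * num_edges F).
  by rewrite /g (avg_prod (fun=> f)) prodr_const -exprM mulnC.
have -> : hom_density F (corr_kernel f) =
    avg (fun x => avg (fun a => g a * g (gauge_action F a x))).
  apply: eq_avg => x.
  rewrite -(avg_prod (fun e b =>
    f b * f ((x (tail e))^-1 * b * x (Defs.head e))%g)).
  apply: eq_avg => a; rewrite big_split; congr (_ * _).
  by apply: eq_bigr => e _; rewrite ffunE.
exact: (@avg_correlation_ge _ _ _ (gauge_action F) [ffun=> 1%g] g).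
Qed.

(** A single edge is an equality case: both factors of the correlation kernel
average independently. *)
Lemma hom_density_dirK2_corr (f : gT -> R) :
  hom_density dirK2 (corr_kernel f) = avg f ^+ 2.
Proof.
have -> : avg f ^+ 2 = avg (fun b => f b * avg f).
  by rewrite (eq_avg (fun b => mulrC (f b) _)) avgZ expr2.
have -> : hom_density dirK2 (corr_kernel f) =
    avg (fun x : {ffun 'I_2 -> gT} => corr_kernel f (x ord0) (x ord_max)).
  by apply: eq_avg => x; apply: (big_pred1 tt); case.
rewrite exchange_avg; apply: eq_avg => b; rewrite avgZ; congr (_ * _).
(* Right translation of the head by a uniform [t] leaves the average over [x]
   unchanged and already makes the argument of [f] uniform. *)
pose d t : {dffun forall _ : 'I_2, gT} :=
  [ffun i => if i == ord_max then t else 1%g].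
pose k (x : {ffun 'I_2 -> gT}) := f ((x ord0)^-1 * b * x ord_max)%g.
transitivity (avg (fun t => avg (fun x => k (x * d t)%g))).
  rewrite -[LHS](avg_const (1%g : gT)); apply: eq_avg => t.
  exact: (avg_reindex k (mulIg (d t))).
rewrite exchange_avg -[RHS](avg_const ([ffun=> 1%g] : {ffun 'I_2 -> gT})).
apply: eq_avg => x.
rewrite [RHS](avg_reindex _ (mulgI ((x ord0)^-1 * b * x ord_max)%g)).
by apply: eq_avg => t; rewrite /k /= !ffunE /= mulg1 !mulgA.
Qed.

End Kernel.

Theorem corollary1p2 (R : realType) (gT : finGroupType) (A : {set gT}) :
  (forall F : digraph,
     hom_density F (coset_kernel R A)
       >= (#|A|%:R / #|gT|%:R) ^+ (2 * num_edges F))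
  /\
  (forall F : digraph,
     hom_density F (coset_kernel R A)
       >= hom_density dirK2 (coset_kernel R A) ^+ num_edges F).
Proof.
have coset_corr F : hom_density F (coset_kernel R A) =
    hom_density F (corr_kernel (fun b => (b \in A)%:R)).
  by apply: eq_avg => x; apply: eq_bigr => e _; apply: coset_kernelE.
split=> F; rewrite !coset_corr.
  by rewrite -avg_indicator; apply: hom_density_corr_ge.
by rewrite hom_density_dirK2_corr -exprM; apply: hom_density_corr_ge.
Qed.
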